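(* Let $\mathfrak m$ be a multisegment, let $\mathcal O=(\Delta_1,\ldots,\Delta_k)$ be an order on $\mathfrak m$, and define $\mathcal O^\vee:=(\Delta_k^\vee,\ldots,\Delta_1^\vee)$, which is an order on $\mathfrak m^\vee$. Then: (a) $\mathcal O$ is standard if and only if $\mathcal O^\vee$ is standard; moreover, the assignment $\mathcal O\mapsto\mathcal O^\vee$ defines a bijection between the standard orders of $\mathfrak m$ and those of $\mathfrak m^\vee$. (b) $\mathcal O$ admits a relevant decomposition if and only if $\mathcal O^\vee$ admits a relevant decomposition. This correspondence preserves triviality: $\mathcal O$ admits a trivial (respectively, non-trivial) relevant decomposition if and only if $\mathcal O^\vee$ does. Consequently, $\mathfrak m$ is distinguished if and only if $\mathfrak m^\vee$ is distinguished.
   Context: A segment is a set $[a,b]=\{a,a+1,\ldots,b\}$ of consecutive integers, $a\le b$; write $\mathbf b([a,b])=a$ (beginning), $\mathbf e([a,b])=b$ (endpoint), and $\mathrm{Sgm}$ for the set of segments. Put $\nu[a,b]=[a+1,b+1]$ and $[a,b]^\vee=[-b,-a]$. A multisegment is a finitely supported function $\mathfrak m:\mathrm{Sgm}\to\mathbb Z_{\ge0}$ (a finite multiset of segments); $\mathfrak m^\vee(\Delta)=\mathfrak m(\Delta^\vee)$. An order of $\mathfrak m$ is a listing $(\Delta_1,\ldots,\Delta_k)$ in which each segment $\Delta$ occurs exactly $\mathfrak m(\Delta)$ times (not necessarily standard). Write $[a,b]\prec[a',b']$ if $a<a'$, $b<b'$ and $b\ge a'-1$. An order is standard if $\Delta_i\not\prec\Delta_j$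 whenever $i<j$. A decomposition of a segment $\Delta$ is a tuple of segments $(\Delta_1,\ldots,\Delta_r)$, $r\ge1$, with $\mathbf e(\Delta_1)=\mathbf e(\Delta)$, $\mathbf b(\Delta_r)=\mathbf b(\Delta)$ and $\mathbf e(\Delta_{i+1})=\mathbf b(\Delta_i)-1$ for $1\le i\le r-1$. A decomposition of an order $(\Delta_1,\ldots,\Delta_k)$ is a choice of a decomposition $(\Delta_{i,1},\ldots,\Delta_{i,k_i})$ of each $\Delta_i$; it is trivial if all $k_i=1$. Its index set is $I=\{(i,j):1\le i\le k,\ 1\le j\le k_i\}$, ordered lexicographically ($\prec_{\mathrm{lex}}$), and $(i,j)\ll(i',j')$ means $i<i'$. The decomposition is relevant to the order if there is an involution $\tau:I\to I$ with: (R1) $\tau(i,j+1)\ll\tau(i,j)$ for all $1\le i\le k$, $1\le j\le k_i-1$; (R2) $\tau(\imath)\ne\imath$ for all $\imath\in I$; (R3) $\Delta_\imath=\nu\Delta_{\tau(\imath)}$ whenever $\imath\prec_{\mathrm{lex}}\tau(\imath)$. $\mathfrak m$ is distinguished if every standard order of $\mathfrak m$ admits a relevant decomposition. *)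

(* Defs.v *)
From HB Require Import structures.
From mathcomp Require Import all_boot all_order all_algebra.
From mathcomp Require Import finmap.
From mathcomp Require Import classical_sets functions.

Set Implicit Arguments.
Unset Strict Implicit.
Unset Printing Implicit Defensive.

Import Order.TTheory GRing.Theory Num.Theory.
Local Open Scope ring_scope.

(* The segment [a, b] = {a, a+1, ..., b} is represented by its pair of
   endpoints, which determines it since a <= b. *)
Record segment := Segment {
  endpoints : int * int;
  endpoints_le : endpoints.1 <= endpoints.2 }.

HB.instance Definition _ := [isSub for endpoints].
HB.instance Definition _ := [Choice of segment by <:].

Definition sbegin (D : segment) : int := (endpoints D).1.
Definition send (D : segment) : int := (endpoints D).2.

Lemma nu_subproof (D : segment) :
  (sbegin D + 1, send D + 1).1 <= (sbegin D + 1, send D + 1).2.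
Proof. by rewrite /= lerD2r endpoints_le. Qed.

Definition nu (D : segment) : segment := Segment (nu_subproof D).

Lemma dual_subproof (D : segment) :
  (- send D, - sbegin D).1 <= (- send D, - sbegin D).2.
Proof. by rewrite /= lerN2 endpoints_le. Qed.

Definition dual (D : segment) : segment := Segment (dual_subproof D).

Lemma dualK : involutive dual.
Proof. by case=> [[a b] ab]; apply: val_inj; rewrite /= /sbegin /send /= !opprK. Qed.

Definition multisegment := {fsfun segment -> nat with 0%N}.

Definition mdual (m : multisegment) : multisegment :=
  [fsfun D in [fset dual D | D in finsupp m]%fset => m (dual D) | 0%N].

Lemma mdualE (m : multisegment) (D : segment) : mdual m D = m (dual D).
Proof.
rewrite /mdual fsfunE; case: ifPn => // /imfsetP nD.
symmetry; apply: fsfun_dflt; apply/negP => mD.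
by apply: nD; exists (dual D); rewrite ?dualK.
Qed.

Definition is_order (m : multisegment) (O : seq segment) : Prop :=
  forall D : segment, count_mem D O = m D.

Definition prec (D D' : segment) : bool :=
  [&& sbegin D < sbegin D', send D < send D' & sbegin D' - 1 <= send D].

Definition standard (O : seq segment) : bool :=
  pairwise (fun D D' => ~~ prec D D') O.

Definition standard_orders (m : multisegment) : set (seq segment) :=
  [set O | is_order m O /\ standard O]%classic.

Definition order_dual (O : seq segment) : seq segment := rev (map dual O).

Definition is_decomposition (D : segment) (s : seq segment) : bool :=
  if s is D1 :: s' then
    [&& send D1 == send D, sbegin (last D1 s') == sbegin D
      & path (fun E E' => send E' == sbegin E - 1) D1 s']
  else false.

Definition is_order_decomposition (O : seq segment) (ds : seq (seq segment)) : bool :=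
  all2 is_decomposition O ds.

Definition trivial_decomposition (ds : seq (seq segment)) : bool :=
  all (fun s => size s == 1%N) ds.

Section Relevance.
Variable ds : seq (seq segment).

(* The indices (i, j), both components starting from 0. *)
Definition dindex := {i : 'I_(size ds) & 'I_(size (tnth (in_tuple ds) i))}.

Definition dsegment (x : dindex) : segment :=
  tnth (in_tuple (tnth (in_tuple ds) (tag x))) (tagged x).

Definition drow (x : dindex) : nat := tag x.
Definition dcol (x : dindex) : nat := tagged x.

Definition dll (x y : dindex) : bool := (drow x < drow y)%N.
Definition dlex (x y : dindex) : bool :=
  (drow x < drow y)%N || (drow x == drow y) && (dcol x < dcol y)%N.

Definition relevant_involution (tau : dindex -> dindex) : Prop :=
  [/\ involutive tau,
      forall x y : dindex, drow y = drow x -> dcol y = (dcol x).+1 -> dll (tau y) (tau x),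
      forall x : dindex, tau x <> x
    & forall x : dindex, dlex x (tau x) -> dsegment x = nu (dsegment (tau x))].

End Relevance.

Definition relevant_decomposition (O : seq segment) (ds : seq (seq segment)) : Prop :=
  is_order_decomposition O ds /\ exists tau : dindex ds -> dindex ds, relevant_involution tau.

Definition admits_relevant (O : seq segment) : Prop :=
  exists ds, relevant_decomposition O ds.

Definition admits_trivial_relevant (O : seq segment) : Prop :=
  exists ds, relevant_decomposition O ds /\ trivial_decomposition ds.

Definition admits_nontrivial_relevant (O : seq segment) : Prop :=
  exists ds, relevant_decomposition O ds /\ ~~ trivial_decomposition ds.

Definition distinguished (m : multisegment) : Prop :=
  forall O, is_order m O -> standard O -> admits_relevant O.

(* Main.v *)
Require Import Defs.
From mathcomp Require Import all_boot all_order all_algebra.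
From mathcomp Require Import finmap.
From mathcomp Require Import classical_sets functions.
From mathcomp Require Import zify.

(** Duality negates the integers, so it exchanges beginnings with endpoints and
    reverses the direction of every relation in sight; listing the dual segments
    backwards restores it.  For orders this gives [standard_dual]: [prec D D']
    is the same as [prec (dual D') (dual D)].

    For decompositions one has to reverse twice.  The pieces of a segment are
    listed from its endpoint down, so the duals of the pieces form a
    decomposition of the dual segment once their order is reversed, and the rows
    are reversed together with the order itself ([decomposition_dual]).  The
    index set is thereby turned upside down by a bijection [flip] which reverses
    both the lexicographic order and the order of rows.  Conjugating the
    involution by [flip] preserves relevance ([relevant_involution_flip]): the two
    sides of the first condition are exchanged twice, once because columns are reversed
    and once because rows are; in the last one, [x] comes before [tau x] after
    the flip exactly when [tau x] came before [x], and the equation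
    [E = nu E'] is equivalent to [dual E' = nu (dual E)].

    Since all these constructions are involutive, each implication for [O]
    applied to [order_dual O] yields its converse. *)

Set Implicit Arguments.
Unset Strict Implicit.
Unset Printing Implicit Defensive.

Import Order.TTheory GRing.Theory Num.Theory.
Local Open Scope ring_scope.

(** * Orders *)

Lemma order_dualK : involutive order_dual.
Proof.
by move=> O; rewrite /order_dual map_rev revK -map_comp map_id_in // => D _ /=; rewrite dualK.
Qed.

Lemma mdualK : involutive mdual.
Proof. by move=> m; apply/fsfunP => D; rewrite !mdualE dualK. Qed.

Lemma is_order_dual m O : is_order m O -> is_order (mdual m) (order_dual O).
Proof.
move=> mO D; rewrite mdualE -mO /order_dual count_rev count_map.
by apply: eq_count => E /=; rewrite (can2_eq dualK dualK).
Qed.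

Lemma prec_dual D D' : prec (dual D) (dual D') = prec D' D.
Proof. by rewrite /prec /dual /sbegin /send /=; lia. Qed.

Lemma pairwise_rev (T : Type) (r : rel T) s :
  pairwise r (rev s) = pairwise (fun x y => r y x) s.
Proof. by elim: s => //= x s IHs; rewrite rev_cons pairwise_rcons all_rev IHs. Qed.

Lemma standard_dual O : standard (order_dual O) = standard O.
Proof.
rewrite /standard /order_dual pairwise_rev pairwise_map.
by apply: eq_pairwise => D D' /=; rewrite prec_dual.
Qed.

(** * Decompositions *)

Definition decomposition_dual (ds : seq (seq segment)) : seq (seq segment) :=
  rev (map order_dual ds).

Lemma decomposition_dualK : involutive decomposition_dual.
Proof.
move=> ds; rewrite /decomposition_dual map_rev revK -map_comp map_id_in //.
by move=> s _ /=; rewrite order_dualK.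
Qed.

(** Pieces are listed from the endpoint of [D] down and duality exchanges
    endpoints with beginnings, so the last piece has to become the first. *)
Lemma is_decomposition_dual D s :
  is_decomposition D s -> is_decomposition (dual D) (order_dual s).
Proof.
case: s => [//|E s] /and3P[/eqP eE /eqP bE sE].
rewrite /order_dual -map_rev lastI rev_rcons /=; apply/and3P; split.
- by rewrite /send /= bE.
- rewrite last_map.
  have -> : last (last E s) (rev (belast E s)) = E.
    by case: (s) => //= F t; rewrite rev_cons last_rcons.
  by rewrite /sbegin /= eE.
- rewrite path_map rev_path; apply: sub_path sE => F G /=.
  by rewrite /dual /sbegin /send /=; lia.
Qed.

Lemma is_order_decomposition_dual O ds :
  is_order_decomposition O ds ->
  is_order_decomposition (order_dual O) (decomposition_dual ds).
Proof.
rewrite /is_order_decomposition /order_dual /decomposition_dual.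
rewrite !all2E !size_rev !size_map => /andP[/eqP sz].
rewrite sz eqxx /= -rev_zip ?size_map // all_rev.
elim: O ds sz => [|D O IHO] [|s ds] //= [/IHO{}IHO] /andP[Ds /IHO ->].
by rewrite is_decomposition_dual.
Qed.

Lemma trivial_decomposition_dual ds :
  trivial_decomposition (decomposition_dual ds) = trivial_decomposition ds.
Proof.
rewrite /trivial_decomposition /decomposition_dual all_rev all_map.
by apply: eq_all => s /=; rewrite size_rev size_map.
Qed.

(** * Indices as positions *)

(** The index types of two decompositions are different dependent types, so the
    flip is computed on bare pairs of numbers and transported afterwards. *)
Definition position ds (x : dindex ds) : nat * nat := (drow x, dcol x).

Definition valid_position (ds : seq (seq segment)) (p : nat * nat) : bool :=
  ((p.1 < size ds) && (p.2 < size (nth [::] ds p.1)))%N.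

Lemma valid_position_of ds (x : dindex ds) : valid_position ds (position x).
Proof.
case: x => i j; rewrite /valid_position /position /drow /dcol /= ltn_ord /=.
by have := ltn_ord j; rewrite {2}(tnth_nth [::]).
Qed.

Lemma position_inj ds : injective (@position ds).
Proof.
move=> [i j] [i' j'] []; rewrite /drow /dcol /= => /val_inj ii'.
by case: _ / ii' j' => j' /val_inj ->.
Qed.

Lemma position_surj ds p :
  valid_position ds p -> {x : dindex ds | position x = p}.
Proof.
case: p => r c /andP[/= rP cP].
have cP' : (c < size (tnth (in_tuple ds) (Ordinal rP)))%N.
  by rewrite (tnth_nth [::]).
by exists (Tagged (fun i => 'I_(size (tnth (in_tuple ds) i))) (Ordinal cP')).
Qed.

Lemma dsegment_nth D ds (x : dindex ds) :
  dsegment x = nth D (nth [::] ds (drow x)) (dcol x).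
Proof.
case: x => i j; rewrite /dsegment /drow /dcol /=.
by rewrite (tnth_nth D) /=; congr (nth D _ _); apply: tnth_nth.
Qed.

(** * The flip of indices *)

Definition flip_position (ds : seq (seq segment)) (p : nat * nat) : nat * nat :=
  (size ds - p.1.+1, size (nth [::] ds p.1) - p.2.+1)%N.

Lemma size_decomposition_dual ds : size (decomposition_dual ds) = size ds.
Proof. by rewrite size_rev size_map. Qed.

Lemma nth_decomposition_dual ds r : (r < size ds)%N ->
  nth [::] (decomposition_dual ds) (size ds - r.+1) = order_dual (nth [::] ds r).
Proof.
move=> rP; rewrite nth_rev size_map; last by lia.
rewrite (nth_map [::]); last by lia.
by congr (order_dual (nth _ _ _)); lia.
Qed.

Lemma size_order_dual O : size (order_dual O) = size O.
Proof. by rewrite size_rev size_map. Qed.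

Lemma valid_flip_position ds p : valid_position ds p ->
  valid_position (decomposition_dual ds) (flip_position ds p).
Proof.
case: p => r c /andP[/= rP cP]; rewrite /valid_position /=.
by rewrite size_decomposition_dual nth_decomposition_dual // size_order_dual; lia.
Qed.

Lemma flip_positionK ds p : valid_position ds p ->
  flip_position (decomposition_dual ds) (flip_position ds p) = p.
Proof.
case: p => r c /andP[/= rP cP]; rewrite /flip_position /=.
rewrite size_decomposition_dual nth_decomposition_dual // size_order_dual.
by congr pair; lia.
Qed.

Definition flip ds (x : dindex ds) : dindex (decomposition_dual ds) :=
  sval (position_surj (valid_flip_position (valid_position_of x))).

Lemma position_flip ds (x : dindex ds) :
  position (flip x) = flip_position ds (position x).
Proof. by rewrite /flip; case: position_surj. Qed.

(** The type of [flip (flip x)] is only propositionally equal to that of [x], so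
    [flip] cannot be stated to be its own inverse; surjectivity provides one. *)
Lemma flip_surj ds (y : dindex (decomposition_dual ds)) :
  {x : dindex ds | flip x = y}.
Proof.
have := valid_flip_position (valid_position_of y).
rewrite decomposition_dualK => /position_surj[x xE]; exists x.
apply: position_inj; rewrite position_flip xE.
by have := flip_positionK (valid_position_of y); rewrite decomposition_dualK.
Qed.

Definition unflip ds (y : dindex (decomposition_dual ds)) : dindex ds :=
  sval (flip_surj y).

Lemma unflipK ds : cancel (@unflip ds) (@flip ds).
Proof. by move=> y; rewrite /unflip; case: flip_surj. Qed.

Lemma flip_inj ds : injective (@flip ds).
Proof.
move=> x y /(congr1 (@position _)); rewrite !position_flip => xy.
apply: position_inj.
by rewrite -(flip_positionK (valid_position_of x)) xy flip_positionK ?valid_position_of.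
Qed.

Lemma flipK ds : cancel (@flip ds) (@unflip ds).
Proof. by move=> x; apply: flip_inj; rewrite unflipK. Qed.

Lemma drow_flip ds (x : dindex ds) : drow (flip x) = (size ds - (drow x).+1)%N.
Proof. by case: (position_flip x). Qed.

Lemma dcol_flip ds (x : dindex ds) :
  dcol (flip x) = (size (nth [::] ds (drow x)) - (dcol x).+1)%N.
Proof. by case: (position_flip x). Qed.

Lemma drow_lt ds (x : dindex ds) : (drow x < size ds)%N.
Proof. by case/andP: (valid_position_of x). Qed.

Lemma dcol_lt ds (x : dindex ds) : (dcol x < size (nth [::] ds (drow x)))%N.
Proof. by case/andP: (valid_position_of x). Qed.

Lemma dll_flip ds (x y : dindex ds) : dll (flip x) (flip y) = dll y x.
Proof.
by rewrite /dll !drow_flip; have := drow_lt x; have := drow_lt y; lia.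
Qed.

Lemma drow_flip_eq ds (x y : dindex ds) :
  (drow (flip x) == drow (flip y)) = (drow x == drow y).
Proof.
by rewrite !drow_flip; have := drow_lt x; have := drow_lt y; lia.
Qed.

(** Reversing the rows alone, or the columns alone, would not reverse the
    lexicographic order: ties between rows are broken by the columns. *)
Lemma dlex_flip ds (x y : dindex ds) : dlex (flip x) (flip y) = dlex y x.
Proof.
rewrite /dlex -![(drow _ < drow _)%N]/(dll _ _) dll_flip drow_flip_eq eq_sym.
case: eqP => //= yx; congr orb.
by rewrite !dcol_flip; have := dcol_lt x; have := dcol_lt y; rewrite yx; lia.
Qed.

Lemma dsegment_flip ds (x : dindex ds) : dsegment (flip x) = dual (dsegment x).
Proof.
pose D := dsegment x; rewrite (dsegment_nth (dual D)) (dsegment_nth D).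
have rP := drow_lt x; have cP := dcol_lt x.
rewrite drow_flip dcol_flip nth_decomposition_dual // nth_rev size_map; last by lia.
rewrite (nth_map D); last by lia.
by congr (dual (nth _ _ _)); lia.
Qed.

(** * Relevance *)

Lemma dual_nu D : dual D = nu (dual (nu D)).
Proof.
apply: val_inj; rewrite /= /dual /nu /sbegin /send /=.
by congr pair; lia.
Qed.

Lemma relevant_involution_flip ds (tau : dindex ds -> dindex ds) :
  relevant_involution tau ->
  relevant_involution (fun y => flip (tau (unflip y))).
Proof.
case=> tauK tau_row tau_fix tau_nu; split.
- by move=> y; rewrite flipK tauK unflipK.
- move=> x y; rewrite -(unflipK x) -(unflipK y) !flipK.
  move: (unflip x) (unflip y) => {}x {}y rE cE.
  have {}rE : drow y = drow x by apply/eqP; rewrite -drow_flip_eq rE.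
  rewrite dll_flip; apply: tau_row => //.
  by move: cE; rewrite !dcol_flip rE; have := dcol_lt x; have := dcol_lt y; rewrite rE; lia.
- move=> y; rewrite -{2}(unflipK y) => /flip_inj; exact: tau_fix.
- move=> y; rewrite -(unflipK y) !flipK; move: (unflip y) => {y} x.
  (* [tau x] now precedes [x = tau (tau x)], so the hypothesis is used at [tau x]. *)
  rewrite dlex_flip !dsegment_flip -{2}(tauK x) => /tau_nu ->.
  by rewrite tauK -dual_nu.
Qed.

Lemma relevant_dual O ds :
  relevant_decomposition O ds ->
  relevant_decomposition (order_dual O) (decomposition_dual ds).
Proof.
case=> dec [tau tauP]; split; first exact: is_order_decomposition_dual.
by exists (fun y => flip (tau (unflip y))); apply: relevant_involution_flip.
Qed.

Lemma involutive_iff (T : Type) (f : T -> T) (P : T -> Prop) (x : T) :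
  involutive f -> (forall y, P y -> P (f y)) -> P x <-> P (f x).
Proof. by move=> fK Pf; split=> [/Pf//|/Pf]; rewrite fK. Qed.

Lemma admits_relevant_dual O :
  admits_relevant O <-> admits_relevant (order_dual O).
Proof.
apply: (involutive_iff _ order_dualK) => {}O [ds /relevant_dual rel].
by exists (decomposition_dual ds).
Qed.

Lemma admits_trivial_relevant_dual O :
  admits_trivial_relevant O <-> admits_trivial_relevant (order_dual O).
Proof.
apply: (involutive_iff _ order_dualK) => {}O [ds [/relevant_dual rel triv]].
by exists (decomposition_dual ds); rewrite trivial_decomposition_dual.
Qed.

Lemma admits_nontrivial_relevant_dual O :
  admits_nontrivial_relevant O <-> admits_nontrivial_relevant (order_dual O).
Proof.
apply: (involutive_iff _ order_dualK) => {}O [ds [/relevant_dual rel triv]].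
by exists (decomposition_dual ds); rewrite trivial_decomposition_dual.
Qed.

Lemma standard_orders_dual m O :
  standard_orders m O -> standard_orders (mdual m) (order_dual O).
Proof. by case=> mO sO; split; [exact: is_order_dual|rewrite standard_dual]. Qed.

Lemma distinguished_dual m : distinguished m <-> distinguished (mdual m).
Proof.
apply: (involutive_iff _ mdualK) => {}m dist O /is_order_dual.
rewrite mdualK => mO sO; apply/admits_relevant_dual.
by apply: dist mO _; rewrite standard_dual.
Qed.

Theorem theorem5p3 (m : multisegment) :
  (forall O : seq segment, is_order m O ->
     is_order (mdual m) (order_dual O)
     /\ (standard O <-> standard (order_dual O))
     /\ (admits_relevant O <-> admits_relevant (order_dual O))
     /\ (admits_trivial_relevant O <-> admits_trivial_relevant (order_dual O))
     /\ (admits_nontrivial_relevant O <-> admits_nontrivial_relevant (order_dual O)))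
  /\ set_bij (standard_orders m) (standard_orders (mdual m)) order_dual
  /\ (distinguished m <-> distinguished (mdual m)).
Proof.
split; [move=> O mO | split; last exact: distinguished_dual].
  split; first exact: is_order_dual.
  split; first by rewrite standard_dual.
  split; first exact: admits_relevant_dual.
  split; first exact: admits_trivial_relevant_dual.
  exact: admits_nontrivial_relevant_dual.
split.
- by move=> O; apply: standard_orders_dual.
- by move=> O O' _ _; apply: (inv_inj order_dualK).
- move=> O /standard_orders_dual; rewrite mdualK => mO.
  by exists (order_dual O) => //; rewrite order_dualK.
Qed.
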